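(* (Total transmission in the limit $\varepsilon\to0$.) Let $\eta\in(0,1)$, $k>0$ and $|\theta|<\pi/2$, and let $$R_0=\frac{i\tan k\,(\eta^2-\cos^2\theta)}{-i\tan k\,(\eta^2+\cos^2\theta)+2\eta\cos\theta},\qquad T_0=\frac{2\eta\cos\theta}{-i\sin k\,(\eta^2+\cos^2\theta)+2\eta\cos\theta\cos k}$$ be the reflection and transmission coefficients of the homogenized slab. Then: (a) if $k=m\pi$ for a positive integer $m$, then $|T_0|=1$ and $R_0=0$ for all incident angles $\theta$; (b) if $\cos\theta=\eta$, then $|T_0|=1$ and $R_0=0$ for all $k>0$.
   Context: $R_0$ and $T_0$ are the reflection and transmission coefficients for the incident wave $u^i=e^{i(\kappa x_1-\zeta(x_2-1))}$, $\kappa=k\sin\theta$, $\zeta=k\cos\theta$, in the layered medium $\nabla\cdot(\frac1\tau\nabla u)+k^2\mu u=0$, with $\tau=\mu=1$ outside the layer $0<x_2<1$ and $\frac1\tau=\mathrm{diag}(0,\eta)$, $\mu=\eta$ inside it: the total field is $u^i+R_0e^{i(\kappa x_1+\zeta(x_2-1))}$ for $x_2>1$ and $T_0e^{i(\kappa x_1-\zeta x_2)}$ for $x_2<0$. This medium is the $\varepsilon\to0$ limit of a perfectly conducting slab of thickness $1$ with slits of width $\varepsilon$ and period $d=\varepsilon/\eta$. When $\cos k=0$ the formula for $R_0$ is read after multiplying numerator and denominator by $\cos k$. *)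

(* Defs.v *)
From Stdlib Require Import Reals.
From Coquelicot Require Import Coquelicot.

Local Open Scope R_scope.
Local Open Scope C_scope.

(* The complex number e^{it} for real t. *)
Definition expi (t : R) : C := (cos t, sin t).

(* Coefficients of the layered medium as functions of x2:
   1/tau = diag (inv_tau1, inv_tau2).  Their values on the interfaces x2 = 0
   and x2 = 1 are never used. *)
Definition layered (inside outside x2 : R) : R :=
  if Rlt_dec 0 x2 then (if Rlt_dec x2 1 then inside else outside) else outside.

Definition inv_tau1 (x2 : R) : R := layered 0 1 x2.
Definition inv_tau2 (eta x2 : R) : R := layered eta 1 x2.
Definition mu (eta x2 : R) : R := layered eta 1 x2.

(* p and q are the partial derivatives of u off the interfaces. *)
Definition is_gradient (u p q : R -> R -> C) : Prop :=
  forall x1 x2 : R, x2 <> 0%R -> x2 <> 1%R ->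
    is_derive (fun s : R => u s x2) x1 (p x1 x2) /\
    is_derive (fun s : R => u x1 s) x2 (q x1 x2).

(* div (1/tau grad u) + k^2 mu u = 0 off the interfaces. *)
Definition solves_pde (eta k : R) (u p q : R -> R -> C) : Prop :=
  forall x1 x2 : R, x2 <> 0%R -> x2 <> 1%R ->
    exists d1 d2 : C,
      is_derive (fun s : R => RtoC (inv_tau1 x2) * p s x2) x1 d1 /\
      is_derive (fun s : R => RtoC (inv_tau2 eta s) * q x1 s) x2 d2 /\
      d1 + d2 + RtoC (k ^ 2 * mu eta x2)%R * u x1 x2 = 0.

(* Transmission conditions implied by the divergence form across x2 = a:
   u is continuous, and the normal flux has the same limit from both sides. *)
Definition transmission_at (eta a : R) (u q : R -> R -> C) : Prop :=
  forall x1 : R,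
    continuous (fun s : R => u x1 s) a /\
    exists l : C,
      filterlim (fun s : R => RtoC (inv_tau2 eta s) * q x1 s)
                (locally' a) (locally l).

(* r and t are the reflection and transmission coefficients for the incident
   wave exp (i (kappa x1 - zeta (x2 - 1))), with kappa = k sin theta and
   zeta = k cos theta. *)
Definition scattering_coefficients (eta k theta : R) (r t : C) : Prop :=
  let kappa := (k * sin theta)%R in
  let zeta := (k * cos theta)%R in
  exists u p q : R -> R -> C,
    is_gradient u p q /\
    solves_pde eta k u p q /\
    transmission_at eta 0 u q /\
    transmission_at eta 1 u q /\
    (forall x1 x2 : R, (1 < x2)%R ->
       u x1 x2 = expi (kappa * x1 - zeta * (x2 - 1)) +
                 r * expi (kappa * x1 + zeta * (x2 - 1))) /\
    (forall x1 x2 : R, (x2 < 0)%R ->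
       u x1 x2 = t * expi (kappa * x1 - zeta * x2)).

(* When cos k = 0, where tan k is meaningless, the numerator and denominator
   are multiplied by cos k. *)
Definition refl_coef (eta k theta : R) : C :=
  let c := cos theta in
  if Req_EM_T (cos k) 0 then
    (Ci * RtoC (sin k) * RtoC (eta ^ 2 - c ^ 2)) /
    (- Ci * RtoC (sin k) * RtoC (eta ^ 2 + c ^ 2) + RtoC (2 * eta * c * cos k))
  else
    (Ci * RtoC (tan k) * RtoC (eta ^ 2 - c ^ 2)) /
    (- Ci * RtoC (tan k) * RtoC (eta ^ 2 + c ^ 2) + RtoC (2 * eta * c)).

Definition trans_coef (eta k theta : R) : C :=
  let c := cos theta in
  RtoC (2 * eta * c) /
  (- Ci * RtoC (sin k) * RtoC (eta ^ 2 + c ^ 2) + RtoC (2 * eta * c * cos k)).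

(* Main.v *)
Require Import Defs.
From Stdlib Require Import Reals Lra.
From Coquelicot Require Import Coquelicot.

(** Inside the slab 1/tau has no horizontal part, so on each vertical line the
    field is a harmonic oscillator w' = v, v' = - k^2 w, where v is the vertical
    derivative, and (v + i l w) exp (- i l x2) is constant for l = k and
    l = - k.  The transmission conditions give w and eta v at both faces in terms
    of r and t, so the two first integrals become two linear equations in (r, t)
    whose determinant is, up to a nonzero factor, the denominator of T_0; it
    does not vanish since sin k and cos k have no common zero.  Conversely a
    solution of this system yields a field made of plane waves in the three
    regions.  When sin k = 0 or cos theta = eta, the denominator of T_0 is its
    numerator times a unimodular number and the numerator of R_0 vanishes. *)

Local Open Scope C_scope.

(** * Complex-valued functions of a real variable *)

(** Both projections and the pairing map are linear, so the chain rule gives the two directions.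
    Complex derivatives thereby reduce to real calculus. *)
Lemma is_derive_C_iff (f : R -> C) (x : R) (l : C) :
  is_derive f x l <->
  is_derive (fun s => fst (f s)) x (fst l) /\
  is_derive (fun s => snd (f s)) x (snd l).
Proof.
split.
- intros H; split.
  + apply (filterdiff_comp' f fst x (fun y => scal y l) fst H).
    apply filterdiff_linear, is_linear_fst.
  + apply (filterdiff_comp' f snd x (fun y => scal y l) snd H).
    apply filterdiff_linear, is_linear_snd.
- intros [H1 H2].
  apply (filterdiff_ext (fun s => (fst (f s), snd (f s)))).
  { intros s; now destruct (f s). }
  assert (H := filterdiff_comp'_2 (fun s => fst (f s)) (fun s => snd (f s)) pair x
           (fun y => scal y (fst l)) (fun y => scal y (snd l)) pair H1 H2).
  refine (filterdiff_ext_lin _ _ _ (H _) _).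
  2: { intros y; now destruct l. }
  apply filterdiff_linear.
  apply (is_linear_prod (T := prod_NormedModule R_AbsRing R_NormedModule R_NormedModule)
            fst snd); [apply is_linear_fst | apply is_linear_snd].
Qed.

(** A ball of [C] is a product of two real balls. The filter is left arbitrary so that one-sided and
    punctured limits are covered too. *)
Lemma filterlim_C_iff {T : Type} (F : (T -> Prop) -> Prop) {FF : Filter F}
    (f : T -> C) (l : C) :
  filterlim f F (locally l) <->
  filterlim (fun s => fst (f s)) F (locally (fst l)) /\
  filterlim (fun s => snd (f s)) F (locally (snd l)).
Proof.
split.
- intros H; destruct l as [a b]; split.
  + exact (filterlim_comp _ _ _ f fst F _ _ H (continuous_fst a b)).
  + exact (filterlim_comp _ _ _ f snd F _ _ H (continuous_snd a b)).
- intros [H1 H2] P [eps HP].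
  change (F (fun s => P (f s))).
  apply (filter_imp (fun s => ball (fst l) eps (fst (f s)) /\ ball (snd l) eps (snd (f s)))).
  + intros s Hs; apply HP; exact Hs.
  + apply filter_and; [apply H1 | apply H2]; exists eps; tauto.
Qed.

Lemma is_derive_C_unique (f : R -> C) (x : R) (l1 l2 : C) :
  is_derive f x l1 -> is_derive f x l2 -> l1 = l2.
Proof.
intros [A1 B1]%is_derive_C_iff [A2 B2]%is_derive_C_iff.
apply injective_projections.
- now rewrite <- (is_derive_unique _ _ _ A1), <- (is_derive_unique _ _ _ A2).
- now rewrite <- (is_derive_unique _ _ _ B1), <- (is_derive_unique _ _ _ B2).
Qed.

Lemma is_derive_Cmult (f g : R -> C) (x : R) (df dg : C) :
  is_derive f x df -> is_derive g x dg ->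
  is_derive (fun s => f s * g s) x (df * g x + f x * dg).
Proof.
intros [F1 F2]%is_derive_C_iff [G1 G2]%is_derive_C_iff.
apply is_derive_C_iff; simpl; split.
- replace (_ + _)%R with (minus (plus (mult (fst df) (fst (g x))) (mult (fst (f x)) (fst dg)))
    (plus (mult (snd df) (snd (g x))) (mult (snd (f x)) (snd dg))))
    by (unfold minus, plus, opp, mult; simpl; ring).
  apply (is_derive_minus (fun s => mult (fst (f s)) (fst (g s)))
           (fun s => mult (snd (f s)) (snd (g s))));
    apply (@is_derive_mult R_AbsRing); try assumption; intros; apply Rmult_comm.
- replace (_ + _)%R with (plus (plus (mult (fst df) (snd (g x))) (mult (fst (f x)) (snd dg)))
    (plus (mult (snd df) (fst (g x))) (mult (snd (f x)) (fst dg))))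
    by (unfold plus, mult; simpl; ring).
  apply (is_derive_plus (fun s => mult (fst (f s)) (snd (g s)))
           (fun s => mult (snd (f s)) (fst (g s))));
    apply (@is_derive_mult R_AbsRing); try assumption; intros; apply Rmult_comm.
Qed.

Lemma is_derive_Cconst (a : C) (x : R) : is_derive (fun _ : R => a) x (RtoC 0).
Proof. exact (@is_derive_const R_AbsRing C_R_NormedModule a x). Qed.

Lemma is_derive_Cscal (a : C) (f : R -> C) (x : R) (df : C) :
  is_derive f x df -> is_derive (fun s => a * f s) x (a * df).
Proof.
intros H; replace (a * df) with (0 * f x + a * df) by ring.
apply (is_derive_Cmult (fun _ => a)); [apply is_derive_Cconst | exact H].
Qed.

Lemma is_derive_Cplus (f g : R -> C) (x : R) (df dg : C) :
  is_derive f x df -> is_derive g x dg ->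
  is_derive (fun s => f s + g s) x (df + dg).
Proof. exact (@is_derive_plus R_AbsRing C_R_NormedModule f g x df dg). Qed.

Lemma filterlim_Cplus {T : Type} (F : (T -> Prop) -> Prop) {FF : Filter F}
    (f g : T -> C) (a b : C) :
  filterlim f F (locally a) -> filterlim g F (locally b) ->
  filterlim (fun s => f s + g s) F (locally (a + b)).
Proof.
intros Hf Hg.
exact (filterlim_comp_2 (G := locally a) (H := locally b) f g Cplus Hf Hg
  (@filterlim_plus R_AbsRing C_R_NormedModule a b)).
Qed.

Lemma filterlim_Cmult {T : Type} (F : (T -> Prop) -> Prop) {FF : Filter F}
    (f g : T -> C) (a b : C) :
  filterlim f F (locally a) -> filterlim g F (locally b) ->
  filterlim (fun s => f s * g s) F (locally (a * b)).
Proof.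
assert (Rmul : forall (f g : T -> R) (a b : R), filterlim f F (locally a) ->
  filterlim g F (locally b) -> filterlim (fun s => f s * g s)%R F (locally (a * b)%R)).
{ intros f' g' a' b' Hf Hg.
  exact (filterlim_comp_2 f' g' Rmult Hf Hg (@filterlim_mult R_AbsRing a' b')). }
assert (Radd : forall (f g : T -> R) (a b : R), filterlim f F (locally a) ->
  filterlim g F (locally b) -> filterlim (fun s => f s + g s)%R F (locally (a + b)%R)).
{ intros f' g' a' b' Hf Hg.
  exact (filterlim_comp_2 f' g' Rplus Hf Hg
           (@filterlim_plus R_AbsRing R_NormedModule a' b')). }
assert (Rneg : forall (f : T -> R) (a : R), filterlim f F (locally a) ->
  filterlim (fun s => - f s)%R F (locally (- a)%R)).
{ intros f' a' Hf.
  exact (filterlim_comp _ _ _ f' Ropp F _ _ Hf (@filterlim_opp R_AbsRing R_NormedModule a')). }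
intros [F1 F2]%filterlim_C_iff [G1 G2]%filterlim_C_iff; try assumption.
apply filterlim_C_iff; [assumption | simpl; split].
- unfold Rminus; apply Radd; [| apply Rneg]; now apply Rmul.
- apply Radd; now apply Rmul.
Qed.

(** * Unimodular exponentials *)

Lemma expi_0 : expi 0 = 1.
Proof. unfold expi; rewrite cos_0, sin_0; reflexivity. Qed.

Lemma expi_plus (a b : R) : expi (a + b) = expi a * expi b.
Proof.
unfold expi; rewrite cos_plus, sin_plus.
apply injective_projections; simpl; ring.
Qed.

Lemma expi_opp_l (a : R) : expi (- a) * expi a = 1.
Proof. rewrite <- expi_plus, Rplus_opp_l; exact expi_0. Qed.

Lemma is_derive_expi (l x : R) :
  is_derive (fun s => expi (l * s)) x (Ci * l * expi (l * x)).
Proof.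
apply is_derive_C_iff; unfold expi; simpl; split;
  (auto_derive; [exact I | ring]).
Qed.

(** * One-sided and punctured neighbourhoods *)

Lemma at_right_le_locally' (a : R) : filter_le (at_right a) (locally' a).
Proof.
intros P H; unfold at_right, locally', within in *.
refine (filter_imp _ _ _ H); intros y Hy Hlt; apply Hy; now apply Rgt_not_eq.
Qed.

Lemma at_left_le_locally' (a : R) : filter_le (at_left a) (locally' a).
Proof.
intros P H; unfold at_left, locally', within in *.
refine (filter_imp _ _ _ H); intros y Hy Hlt; apply Hy; now apply Rlt_not_eq.
Qed.

Lemma locally'_le_locally (a : R) : filter_le (locally' a) (locally a).
Proof. exact (filter_le_within _). Qed.

Lemma at_right_lt (a b : R) : (a < b)%R -> at_right a (fun s => a < s < b)%R.
Proof.
intros H; unfold at_right, within.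
refine (filter_imp _ _ _ (open_lt b a H)); intros s; tauto.
Qed.

Lemma at_left_lt (a b : R) : (a < b)%R -> at_left b (fun s => a < s < b)%R.
Proof.
intros H; unfold at_left, within.
refine (filter_imp _ _ _ (open_gt a b H)); intros s; split; tauto.
Qed.

Lemma filterlim_locally'_sides {T : Type} (f : R -> T) (a : R) (G : (T -> Prop) -> Prop) :
  filterlim f (at_left a) G -> filterlim f (at_right a) G ->
  filterlim f (locally' a) G.
Proof.
intros Hl Hr P HP; specialize (Hl P HP); specialize (Hr P HP).
unfold filtermap, at_left, at_right, locally', within in *.
refine (filter_imp _ _ _ (filter_and _ _ Hl Hr)).
intros y [H1 H2] Hne; destruct (Rdichotomy _ _ Hne); auto.
Qed.

Lemma filterlim_locally'_continuous {T : UniformSpace} (f : R -> T) (a : R) :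
  filterlim f (locally' a) (locally (f a)) -> continuous f a.
Proof.
intros H P HP; specialize (H P HP).
unfold filtermap, locally', within in *.
refine (filter_imp _ _ _ H); intros y Hy.
destruct (Req_dec y a) as [-> | Hne]; [now apply locally_singleton | auto].
Qed.

(** * Oscillator and interfaces *)

Lemma Ci_sqr : Ci * Ci = - (1).
Proof. apply injective_projections; simpl; ring. Qed.

Lemma RtoC_neq_0 (x : R) : x <> 0%R -> RtoC x <> 0.
Proof. intros H E; apply H, RtoC_inj, E. Qed.

(** General solution of $w'' = -l^2 w$, used with [l] equal to [zeta] outside the slab and to [k]
    inside. Differentiation multiplies by $il$ and flips the sign of [b], so fluxes stay in the same
    family. *)
Definition wave (a b : C) (l s : R) : C :=
  a * expi (l * s) + b * expi (- l * s).

Lemma is_derive_wave (a b : C) (l x : R) :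
  is_derive (wave a b l) x (Ci * l * wave a (- b) l x).
Proof.
replace (Ci * l * wave a (- b) l x)
  with (a * (Ci * l * expi (l * x)) + b * (Ci * (- l)%R * expi (- l * x)))
  by (unfold wave; rewrite RtoC_opp; ring).
apply is_derive_Cplus; apply is_derive_Cscal, is_derive_expi.
Qed.

Lemma is_derive_dwave (a b : C) (l x : R) :
  is_derive (fun s => Ci * l * wave a (- b) l s) x (- (l ^ 2)%R * wave a b l x).
Proof.
replace (- (l ^ 2)%R * wave a b l x)
  with (Ci * l * (Ci * l * wave a (- - b) l x)).
- apply is_derive_Cscal, is_derive_wave.
- replace (- - b) with b by ring.
  rewrite RtoC_pow; transitivity (Ci * Ci * (l ^ 2 * wave a b l x)); [ring |].
  rewrite Ci_sqr; ring.
Qed.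

Lemma is_derive_C_continuous (f : R -> C) (x : R) (l : C) :
  is_derive f x l -> continuous f x.
Proof.
intros H.
apply (@ex_derive_continuous R_AbsRing C_R_NormedModule); now exists l.
Qed.

(** Separates the horizontal phase, with [a] standing for $\kappa x_1$; the shift by 1 in $x_2-1$ is
    absorbed into the two amplitudes. *)
Lemma incident_reflected_wave (r : C) (z a s : R) :
  expi (a - z * (s - 1)) + r * expi (a + z * (s - 1)) =
  expi a * wave (r * expi (- z)) (expi z) z s.
Proof.
replace (a - z * (s - 1))%R with (a + z + - z * s)%R by ring.
replace (a + z * (s - 1))%R with (a + - z + z * s)%R by ring.
unfold wave; rewrite !expi_plus; ring.
Qed.

Lemma transmitted_wave (t : C) (z a s : R) :
  t * expi (a - z * s) = expi a * wave 0 t z s.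
Proof.
replace (a - z * s)%R with (a + - z * s)%R by ring.
unfold wave; rewrite expi_plus; ring.
Qed.

(** [F] is constant on the open interval, so both limits equal its value at the midpoint. Limits
    replace endpoint values because the vertical derivative of the field is not prescribed on the
    faces. *)
Lemma null_derive_limits (F : R -> C) (a b : R) (la lb : C) :
  (a < b)%R ->
  (forall s : R, (a < s < b)%R -> is_derive F s (RtoC 0)) ->
  filterlim F (at_right a) (locally la) ->
  filterlim F (at_left b) (locally lb) -> la = lb.
Proof.
intros Hab HF Ha Hb.
assert (Hlt : forall x y : R, (a < x)%R -> (x < y)%R -> (y < b)%R -> F x = F y).
{ intros x y Hx Hxy Hy.
  apply (@eq_is_derive C_R_NormedModule F x y); [| exact Hxy].
  intros t Ht; apply HF; lra. }
set (m := ((a + b) / 2)%R).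
assert (Hm : forall s : R, (a < s < b)%R -> F s = F m).
{ intros s Hs; unfold m.
  destruct (Rtotal_order s ((a + b) / 2)) as [H | [-> | H]];
    [apply Hlt | reflexivity | symmetry; apply Hlt]; lra. }
transitivity (F m).
- apply (@filterlim_locally_unique R R_AbsRing C_R_NormedModule (at_right a) _ F); [exact Ha |].
  refine (filterlim_ext_loc (fun _ => F m) F _ (filterlim_const (F m))).
  refine (filter_imp _ _ _ (at_right_lt a b Hab)).
  intros s Hs; symmetry; now apply Hm.
- symmetry.
  apply (@filterlim_locally_unique R R_AbsRing C_R_NormedModule (at_left b) _ F); [exact Hb |].
  refine (filterlim_ext_loc (fun _ => F m) F _ (filterlim_const (F m))).
  refine (filter_imp _ _ _ (at_left_lt a b Hab)).
  intros s Hs; symmetry; now apply Hm.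
Qed.

(* [(v + i l w) e^{-ils}] is a first integral of [w' = v], [v' = - l^2 w]. *)
Lemma oscillator_limits (l : R) (w v : R -> C) (w0 v0 w1 v1 : C) :
  (forall s : R, (0 < s < 1)%R ->
     is_derive w s (v s) /\ is_derive v s (- (l ^ 2)%R * w s)) ->
  filterlim w (at_right 0) (locally w0) ->
  filterlim v (at_right 0) (locally v0) ->
  filterlim w (at_left 1) (locally w1) ->
  filterlim v (at_left 1) (locally v1) ->
  v1 + Ci * l * w1 = (v0 + Ci * l * w0) * expi l.
Proof.
intros Hd Hw0 Hv0 Hw1 Hv1.
assert (Hexp : forall (F : (R -> Prop) -> Prop) (a : R), filter_le F (locally a) ->
  filterlim (fun s => expi (- l * s)) F (locally (expi (- l * a)))).
{ intros F a HF; refine (filterlim_filter_le_1 _ HF _).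
  exact (is_derive_C_continuous _ _ _ (is_derive_expi (- l) a)). }
assert (Hr : filter_le (at_right 0) (locally 0)) by exact (filter_le_within _).
assert (Hl : filter_le (at_left 1) (locally 1)) by exact (filter_le_within _).
assert (E : (v0 + Ci * l * w0) * expi (- l * 0) = (v1 + Ci * l * w1) * expi (- l * 1)).
{ apply (null_derive_limits (fun s => (v s + Ci * l * w s) * expi (- l * s)) 0 1 _ _ Rlt_0_1).
  - intros s Hs; destruct (Hd s Hs) as [Hw Hv].
    replace (RtoC 0) with
      ((- (l ^ 2)%R * w s + Ci * l * v s) * expi (- l * s) +
       (v s + Ci * l * w s) * (Ci * (- l)%R * expi (- l * s))).
    + exact (is_derive_Cmult _ _ s _ _
               (is_derive_Cplus _ _ s _ _ Hv (is_derive_Cscal (Ci * l) _ s _ Hw))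
               (is_derive_expi (- l) s)).
    + rewrite RtoC_opp, RtoC_pow.
      (* The terms in [v s] cancel outright, and those in [w s] collect the factor $1+i^2=0$. *)
      transitivity (- (1 + Ci * Ci) * (l ^ 2 * w s * expi (- l * s))); [ring |].
      rewrite Ci_sqr; ring.
  - apply filterlim_Cmult; [apply _ | | now apply Hexp].
    apply filterlim_Cplus; [apply _ | exact Hv0 |].
    apply filterlim_Cmult; [apply _ | apply filterlim_const | exact Hw0].
  - apply filterlim_Cmult; [apply _ | | now apply Hexp].
    apply filterlim_Cplus; [apply _ | exact Hv1 |].
    apply filterlim_Cmult; [apply _ | apply filterlim_const | exact Hw1]. }
rewrite Rmult_0_r, Rmult_1_r, expi_0, Cmult_1_r in E.
rewrite E, <- (Cmult_assoc _ (expi (- l))), expi_opp_l; ring.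
Qed.

(** Outside, the field is an explicit wave, so uniqueness of limits along [Fout] determines the
    trace [w a] and the flux limit [f]. Both pass to the inner side [Fin], where dividing the flux
    by [eta] recovers [v]. Abstract filters let one proof serve both faces. *)
Lemma interface_limits (eta a l : R) (A B f : C) (w v : R -> C)
    (Fout Fin : (R -> Prop) -> Prop) :
  ProperFilter' Fout -> Filter Fin -> (0 < eta)%R ->
  filter_le Fout (locally' a) -> filter_le Fin (locally' a) ->
  Fout (fun s => w s = wave A B l s /\
                 RtoC (inv_tau2 eta s) * v s = Ci * l * wave A (- B) l s) ->
  Fin (fun s => inv_tau2 eta s = eta) ->
  continuous w a ->
  filterlim (fun s => RtoC (inv_tau2 eta s) * v s) (locally' a) (locally f) ->
  filterlim w Fin (locally (wave A B l a)) /\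
  filterlim v Fin (locally (/ eta * (Ci * l * wave A (- B) l a))).
Proof.
intros PFout FFin Heta Hout Hin Eout Ein Hw Hf.
assert (FF : Filter Fout) by apply PFout.
assert (le_loc : forall F, filter_le F (locally' a) -> filter_le F (locally a)).
{ intros F H P HP; apply H, locally'_le_locally, HP. }
assert (Ew : w a = wave A B l a).
{ apply (@filterlim_locally_unique R R_AbsRing C_R_NormedModule Fout _ w).
  - exact (filterlim_filter_le_1 _ (le_loc _ Hout) Hw).
  - apply (filterlim_ext_loc (wave A B l)).
    + refine (filter_imp _ _ _ Eout); intros s [H _]; now symmetry.
    + refine (filterlim_filter_le_1 _ (le_loc _ Hout) _).
      exact (is_derive_C_continuous _ _ _ (is_derive_wave A B l a)). }
assert (Ef : f = Ci * l * wave A (- B) l a).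
{ apply (@filterlim_locally_unique R R_AbsRing C_R_NormedModule Fout _
           (fun s => RtoC (inv_tau2 eta s) * v s)).
  - exact (filterlim_filter_le_1 _ Hout Hf).
  - apply (filterlim_ext_loc (fun s => Ci * l * wave A (- B) l s)).
    + refine (filter_imp _ _ _ Eout); intros s [_ H]; now symmetry.
    + refine (filterlim_filter_le_1 _ (le_loc _ Hout) _).
      exact (is_derive_C_continuous _ _ _ (is_derive_dwave A B l a)). }
rewrite <- Ew, <- Ef; split.
- exact (filterlim_filter_le_1 _ (le_loc _ Hin) Hw).
- apply (filterlim_ext_loc (fun s => / eta * (RtoC (inv_tau2 eta s) * v s))).
  + refine (filter_imp _ _ _ Ein); intros s ->.
    field; apply RtoC_neq_0; lra.
  + apply filterlim_Cmult; [exact FFin | apply filterlim_const |].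
    exact (filterlim_filter_le_1 _ Hin Hf).
Qed.

(** * The linear system for the scattering coefficients *)

Lemma Cmult_eq_reg_l (a x y : C) : a <> 0 -> a * x = a * y -> x = y.
Proof.
intros Ha H.
now rewrite <- (Cmult_1_l x), <- (Cmult_1_l y), <- (Cinv_l a Ha), <- !Cmult_assoc, H.
Qed.

Lemma eq_Cdiv_iff (x n d : C) : d <> 0 -> x = n / d <-> x * d = n.
Proof.
intros Hd; split.
- intros ->; field; exact Hd.
- intros <-; field; exact Hd.
Qed.

(** Pure linear algebra: [h], [c], [S], [K] stand for [eta], [cos theta], [sin k], [cos k]. *)
Lemma scattering_system (h c S K r t : C) :
  let D := - Ci * S * (h ^ 2 + c ^ 2) + 2 * h * c * K in
  h <> 0 -> D <> 0 ->
  (c * (r - 1) + h * (1 + r) = (h - c) * t * (K + Ci * S) /\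
   c * (r - 1) - h * (1 + r) = - (c + h) * t * (K - Ci * S)) <->
  (r * D = Ci * S * (h ^ 2 - c ^ 2) /\ t * D = 2 * h * c).
Proof.
intros D Hh HD.
assert (H2 : RtoC 2 <> 0) by (apply RtoC_neq_0; lra).
split; intros [E1 E2].
- assert (Et : t * D = 2 * h * c).
  (* Weighting the equations by [c - h] and [c + h] and subtracting cancels [r] and leaves
     [4 * h * c]. *)
  { apply (Cmult_eq_reg_l 2); [exact H2 |].
    transitivity ((c * (r - 1) + h * (1 + r)) * (c - h) -
                  (c * (r - 1) - h * (1 + r)) * (c + h)); [rewrite E1, E2; unfold D |]; ring. }
  split; [| exact Et].
  (* The difference of the two left-hand sides is [2 * h * (1 + r)], which yields [r] once [t * D]
     is known. *)
  apply (Cmult_eq_reg_l (2 * h)); [now apply Cmult_neq_0 |].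
  transitivity (((c * (r - 1) + h * (1 + r)) - (c * (r - 1) - h * (1 + r))) * D - 2 * h * D);
    [ring |].
  rewrite E1, E2.
  transitivity ((t * D) * (2 * h * K - 2 * Ci * c * S) - 2 * h * D); [ring |].
  rewrite Et; unfold D; ring.
- split; apply (Cmult_eq_reg_l D _ _ HD).
  + transitivity (c * (r * D - D) + h * (D + r * D)); [ring |].
    transitivity ((h - c) * (t * D) * (K + Ci * S)); [| ring].
    rewrite E1, E2; unfold D; ring.
  + transitivity (c * (r * D - D) - h * (D + r * D)); [ring |].
    transitivity (- (c + h) * (t * D) * (K - Ci * S)); [| ring].
    rewrite E1, E2; unfold D; ring.
Qed.

(** * Closed forms of the two coefficients *)

(** The denominator of $T_0$, and also that of $R_0$ once cleared of [tan k]. *)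
Definition scat_den (eta k c : R) : C :=
  - Ci * RtoC (sin k) * RtoC (eta ^ 2 + c ^ 2) + RtoC (2 * eta * c * cos k).

(** The real part is a positive multiple of [cos k] and the imaginary part a negative multiple of
    [sin k]; these have no common zero. *)
Lemma scat_den_neq_0 (eta k c : R) :
  (0 < eta)%R -> (0 < c)%R -> scat_den eta k c <> 0.
Proof.
intros He Hc E.
assert (Er := f_equal fst E); assert (Ei := f_equal snd E).
unfold scat_den in Er, Ei; simpl in Er, Ei.
assert (Hec : (0 < 2 * eta * c)%R) by (apply Rmult_lt_0_compat; lra).
assert (Hs : (0 < eta ^ 2 + c ^ 2)%R)
  by (apply Rplus_lt_0_compat; apply pow_lt; assumption).
assert (Hcos : cos k = 0%R).
{ apply (Rmult_eq_reg_l (2 * eta * c)); lra. }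
assert (Hsin : sin k = 0%R).
{ apply (Rmult_eq_reg_l (eta ^ 2 + c ^ 2)); simpl in *; lra. }
generalize (sin2_cos2 k); unfold Rsqr; rewrite Hcos, Hsin; lra.
Qed.

Lemma trans_coef_eq (eta k theta : R) :
  trans_coef eta k theta = RtoC (2 * eta * cos theta) / scat_den eta k (cos theta).
Proof. reflexivity. Qed.

(** Multiplying the [tan k] form by [cos k] gives the form already chosen when [cos k] vanishes, so
    the case distinction disappears. *)
Lemma refl_coef_eq (eta k theta : R) :
  (0 < eta)%R -> (0 < cos theta)%R ->
  refl_coef eta k theta =
  Ci * RtoC (sin k) * RtoC (eta ^ 2 - cos theta ^ 2) / scat_den eta k (cos theta).
Proof.
intros He Hc; assert (HD := scat_den_neq_0 eta k _ He Hc).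
unfold refl_coef; destruct (Req_EM_T (cos k) 0) as [_ | Hk]; [reflexivity |].
assert (HkC := RtoC_neq_0 _ Hk).
assert (ED : - Ci * RtoC (tan k) * RtoC (eta ^ 2 + cos theta ^ 2) +
             RtoC (2 * eta * cos theta) = scat_den eta k (cos theta) / RtoC (cos k)).
{ unfold scat_den, tan; rewrite RtoC_div by exact Hk.
  rewrite (RtoC_mult _ (cos k)); field; exact HkC. }
rewrite ED; unfold tan; rewrite RtoC_div by exact Hk.
field; split; assumption.
Qed.

(** The two equations are the first integrals for $l=k$ and $l=-k$ compared at the faces, multiplied
    by [eta] and divided by $ik$. *)
Lemma scattering_system_iff (eta k theta : R) (r t : C) :
  (0 < eta)%R -> (0 < cos theta)%R ->
  let c := cos theta in
  (c * (r - 1) + eta * (1 + r) = (eta - c) * t * expi k /\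
   c * (r - 1) - eta * (1 + r) = - (c + eta) * t * expi (- k)) <->
  (r = refl_coef eta k theta /\ t = trans_coef eta k theta).
Proof.
intros He Hc c.
assert (HD := scat_den_neq_0 eta k _ He Hc).
rewrite refl_coef_eq, trans_coef_eq by assumption.
rewrite !eq_Cdiv_iff by exact HD.
assert (Ep : expi k = cos k + Ci * sin k)
  by (apply injective_projections; simpl; ring).
assert (Em : expi (- k) = cos k - Ci * sin k)
  by (unfold expi; rewrite cos_neg, sin_neg; apply injective_projections; simpl; ring).
assert (ED : scat_den eta k c =
  - Ci * sin k * (RtoC eta ^ 2 + RtoC c ^ 2) + 2 * RtoC eta * RtoC c * cos k)
  by (unfold scat_den; rewrite !RtoC_mult, RtoC_plus, !RtoC_pow; reflexivity).
fold c; fold c in HD; rewrite Ep, Em, RtoC_minus, !RtoC_mult, !RtoC_pow.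
rewrite ED in *.
apply scattering_system; [apply RtoC_neq_0; lra | exact HD].
Qed.

(** * Total transmission *)

Lemma Cmod_expi (a : R) : Cmod (expi a) = 1%R.
Proof.
unfold Cmod, expi; simpl.
replace (_ + _)%R with 1%R; [exact sqrt_1 |].
generalize (sin2_cos2 a); unfold Rsqr; lra.
Qed.

Lemma total_transmission_resonance (eta k theta : R) :
  (0 < eta)%R -> (0 < cos theta)%R -> sin k = 0%R ->
  Cmod (trans_coef eta k theta) = 1%R /\ refl_coef eta k theta = RtoC 0.
Proof.
intros He Hc Hs.
assert (HD := scat_den_neq_0 eta k _ He Hc).
rewrite refl_coef_eq, trans_coef_eq by assumption; split.
(* Since [sin k] vanishes, [expi k] is just [cos k], the only surviving factor. *)
- assert (ED : scat_den eta k (cos theta) = RtoC (2 * eta * cos theta) * expi k).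
  { unfold scat_den, expi; rewrite Hs; apply injective_projections; simpl; ring. }
  rewrite Cmod_div by exact HD; rewrite ED, Cmod_mult, Cmod_expi.
  rewrite Rmult_1_r; apply Rdiv_diag.
  rewrite Cmod_R; apply Rgt_not_eq, Rabs_pos_lt, Rgt_not_eq.
  repeat apply Rmult_lt_0_compat; lra.
- rewrite Hs; field; exact HD.
Qed.

Lemma total_transmission_matched (eta k theta : R) :
  (0 < eta)%R -> cos theta = eta ->
  Cmod (trans_coef eta k theta) = 1%R /\ refl_coef eta k theta = RtoC 0.
Proof.
intros He Hc.
assert (Hc' : (0 < cos theta)%R) by lra.
assert (HD := scat_den_neq_0 eta k _ He Hc').
rewrite refl_coef_eq, trans_coef_eq by assumption; split.
(* When $\cos\theta=\eta$, $\eta^2+\cos^2\theta = 2\eta\cos\theta$ factors out and leaves $\cos k -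
   i\sin k$. *)
- assert (ED : scat_den eta k (cos theta) = RtoC (2 * eta * cos theta) * expi (- k)).
  { unfold scat_den, expi; rewrite Hc, cos_neg, sin_neg.
    apply injective_projections; simpl; ring. }
  rewrite Cmod_div by exact HD; rewrite ED, Cmod_mult, Cmod_expi.
  rewrite Rmult_1_r; apply Rdiv_diag.
  rewrite Cmod_R; apply Rgt_not_eq, Rabs_pos_lt, Rgt_not_eq.
  repeat apply Rmult_lt_0_compat; lra.
- rewrite Hc, Rminus_diag; field; rewrite <- Hc at 2; exact HD.
Qed.

(** * From the scattering problem to the system *)

Lemma layered_below (a b x : R) : (x < 0)%R -> layered a b x = b.
Proof. intros H; unfold layered; destruct (Rlt_dec 0 x); [lra | reflexivity]. Qed.

Lemma layered_above (a b x : R) : (1 < x)%R -> layered a b x = b.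
Proof.
intros H; unfold layered; destruct (Rlt_dec 0 x); [| reflexivity].
destruct (Rlt_dec x 1); [lra | reflexivity].
Qed.

Lemma layered_inside (a b x : R) : (0 < x < 1)%R -> layered a b x = a.
Proof.
intros H; unfold layered; destruct (Rlt_dec 0 x); [| lra].
destruct (Rlt_dec x 1); [reflexivity | lra].
Qed.

Lemma wave_at_0 (b : C) (l : R) : wave 0 b l 0 = b.
Proof. unfold wave; rewrite !Rmult_0_r, expi_0; ring. Qed.

Lemma wave_reflected_at_1 (r : C) (l : R) :
  wave (r * expi (- l)) (expi l) l 1 = r + 1.
Proof.
unfold wave; rewrite !Rmult_1_r.
transitivity ((r + 1) * (expi (- l) * expi l)); [ring |].
rewrite expi_opp_l; ring.
Qed.

Lemma wave_reflected_flux_at_1 (r : C) (l : R) :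
  wave (r * expi (- l)) (- expi l) l 1 = r - 1.
Proof.
unfold wave; rewrite !Rmult_1_r.
transitivity ((r - 1) * (expi (- l) * expi l)); [ring |].
rewrite expi_opp_l; ring.
Qed.

(** It suffices to look at the vertical line $x_1=0$, where the horizontal phase is 1. *)
Lemma scattering_coefficients_system (eta k theta : R) (r t : C) :
  (0 < eta)%R -> (0 < k)%R ->
  scattering_coefficients eta k theta r t ->
  let c := cos theta in
  c * (r - 1) + eta * (1 + r) = (eta - c) * t * expi k /\
  c * (r - 1) - eta * (1 + r) = - (c + eta) * t * expi (- k).
Proof.
intros Heta Hk H c; revert H.
set (kappa := (k * sin theta)%R); set (zeta := (k * c)%R).
intros (u & p & q & Hgrad & Hpde & Ht0 & Ht1 & Habove & Hbelow).
fold c kappa zeta in Habove, Hbelow.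
assert (Eb : forall s, (s < 0)%R -> u 0%R s = wave 0 t zeta s).
{ intros s Hs; rewrite Hbelow, transmitted_wave, Rmult_0_r, expi_0 by exact Hs; ring. }
assert (Ea : forall s, (1 < s)%R ->
  u 0%R s = wave (r * expi (- zeta)) (expi zeta) zeta s).
{ intros s Hs; rewrite Habove, incident_reflected_wave, Rmult_0_r, expi_0 by exact Hs; ring. }
assert (Hq : forall s, s <> 0%R -> s <> 1%R -> is_derive (u 0%R) s (q 0%R s)).
{ intros s H0 H1; exact (proj2 (Hgrad 0%R s H0 H1)). }
(* Only [u] is prescribed outside the slab; uniqueness of the derivative identifies [q] there. *)
assert (Qb : forall s, (s < 0)%R -> q 0%R s = Ci * zeta * wave 0 (- t) zeta s).
{ intros s Hs; apply (is_derive_C_unique (u 0%R) s); [apply Hq; lra |].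
  refine (is_derive_ext_loc (wave 0 t zeta) (u 0%R) s _ _ (is_derive_wave _ _ _ s)).
  refine (filter_imp _ _ _ (open_lt 0 s Hs)); intros y Hy; symmetry; now apply Eb. }
assert (Qa : forall s, (1 < s)%R ->
  q 0%R s = Ci * zeta * wave (r * expi (- zeta)) (- expi zeta) zeta s).
{ intros s Hs; apply (is_derive_C_unique (u 0%R) s); [apply Hq; lra |].
  refine (is_derive_ext_loc (wave (r * expi (- zeta)) (expi zeta) zeta) (u 0%R) s _ _
            (is_derive_wave _ _ _ s)).
  refine (filter_imp _ _ _ (open_gt 1 s Hs)); intros y Hy; symmetry; now apply Ea. }
assert (HetaC : RtoC eta <> 0) by (apply RtoC_neq_0; lra).
assert (HkC : RtoC k <> 0) by (apply RtoC_neq_0; lra).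
(* Inside, [inv_tau1] is 0, which forces [d1 = 0]; what remains of the equation is divided by
   [eta]. *)
assert (Hin : forall s, (0 < s < 1)%R ->
  is_derive (u 0%R) s (q 0%R s) /\ is_derive (q 0%R) s (- (k ^ 2)%R * u 0%R s)).
{ intros s Hs; split; [apply Hq; lra |].
  assert (Hs0 : s <> 0%R) by lra; assert (Hs1 : s <> 1%R) by lra.
  destruct (Hpde 0%R s Hs0 Hs1) as (d1 & d2 & D1 & D2 & E).
  unfold inv_tau1 in D1; rewrite layered_inside in D1 by exact Hs.
  unfold mu in E; rewrite layered_inside in E by exact Hs.
  assert (E1 : d1 = 0).
  { apply (is_derive_C_unique _ _ _ _ D1).
    refine (is_derive_ext (fun _ : R => RtoC 0) _ _ _ _ (is_derive_Cconst 0 _)).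
    intros y; symmetry; exact (Cmult_0_l _). }
  replace (- (k ^ 2)%R * u 0%R s) with (/ eta * d2).
  - refine (is_derive_ext_loc _ _ _ _ _ (is_derive_Cscal (/ eta) _ _ _ D2)).
    refine (filter_imp _ _ _ (filter_and _ _ (open_gt 0 s (proj1 Hs)) (open_lt 1 s (proj2 Hs)))).
    intros y Hy; unfold inv_tau2; rewrite layered_inside by exact Hy.
    change (/ eta * (RtoC eta * q 0%R y) = q 0%R y); field; exact HetaC.
  - rewrite E1, RtoC_mult in E.
    replace d2 with ((0 + d2 + RtoC (k ^ 2) * RtoC eta * u 0%R s) -
                     RtoC (k ^ 2) * RtoC eta * u 0%R s) by ring.
    rewrite E; field; exact HetaC. }
destruct (Ht0 0%R) as (C0 & f0 & F0); destruct (Ht1 0%R) as (C1 & f1 & F1).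
destruct (interface_limits eta 0 zeta 0 t f0 (u 0%R) (q 0%R) (at_left 0) (at_right 0))
  as [W0 V0]; try assumption; try apply _.
{ apply at_left_le_locally'. }
{ apply at_right_le_locally'. }
{ refine (filter_imp _ _ _ (at_left_lt (- (1)) 0 _)); [| lra].
  intros s Hs; split; [apply Eb; lra |].
  unfold inv_tau2; rewrite layered_below, Qb by lra; ring. }
{ refine (filter_imp _ _ _ (at_right_lt 0 1 Rlt_0_1)).
  intros s Hs; now apply layered_inside. }
destruct (interface_limits eta 1 zeta (r * expi (- zeta)) (expi zeta) f1
            (u 0%R) (q 0%R) (at_right 1) (at_left 1))
  as [W1 V1]; try assumption; try apply _.
{ apply at_right_le_locally'. }
{ apply at_left_le_locally'. }
{ refine (filter_imp _ _ _ (at_right_lt 1 2 _)); [| lra].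
  intros s Hs; split; [apply Ea; lra |].
  unfold inv_tau2; rewrite layered_above, Qa by lra; ring. }
{ refine (filter_imp _ _ _ (at_left_lt 0 1 Rlt_0_1)).
  intros s Hs; now apply layered_inside. }
rewrite wave_at_0 in W0, V0.
rewrite wave_reflected_at_1 in W1; rewrite wave_reflected_flux_at_1 in V1.
assert (O1 := oscillator_limits k _ _ _ _ _ _ Hin W0 V0 W1 V1).
(* The oscillator sees only $l^2$, so $l=-k$ provides a second first integral. *)
assert (Hin' : forall s, (0 < s < 1)%R ->
  is_derive (u 0%R) s (q 0%R s) /\ is_derive (q 0%R) s (- ((- k) ^ 2)%R * u 0%R s)).
{ replace ((- k) ^ 2)%R with (k ^ 2)%R by ring; exact Hin. }
assert (O2 := oscillator_limits (- k) _ _ _ _ _ _ Hin' W0 V0 W1 V1).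
unfold zeta in O1, O2; rewrite RtoC_opp in O2; rewrite RtoC_mult in O1, O2.
assert (HCik : Ci * k <> 0) by (apply Cmult_neq_0; [exact Ci_nz | exact HkC]).
split; apply (Cmult_eq_reg_l (Ci * k) _ _ HCik).
- transitivity (eta * (/ eta * (Ci * (k * c) * (r - 1)) + Ci * k * (r + 1)));
    [field; exact HetaC |].
  rewrite O1; field; exact HetaC.
- transitivity (eta * (/ eta * (Ci * (k * c) * (r - 1)) + Ci * (- k) * (r + 1)));
    [field; exact HetaC |].
  rewrite O2; field; exact HetaC.
Qed.

(** * From the system to the scattering problem *)

(** Each face belongs to the piece below it: 0 to [f] and 1 to [g]. *)
Definition piecewise {T : Type} (f g h : R -> T) (s : R) : T :=
  if Rle_dec s 0 then f s else if Rle_dec s 1 then g s else h s.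

Lemma piecewise_below {T : Type} (f g h : R -> T) (s : R) :
  (s <= 0)%R -> piecewise f g h s = f s.
Proof. intros H; unfold piecewise; destruct (Rle_dec s 0); [reflexivity | lra]. Qed.

Lemma piecewise_inside {T : Type} (f g h : R -> T) (s : R) :
  (0 < s <= 1)%R -> piecewise f g h s = g s.
Proof.
intros H; unfold piecewise; destruct (Rle_dec s 0); [lra |].
destruct (Rle_dec s 1); [reflexivity | lra].
Qed.

Lemma piecewise_above {T : Type} (f g h : R -> T) (s : R) :
  (1 < s)%R -> piecewise f g h s = h s.
Proof.
intros H; unfold piecewise; destruct (Rle_dec s 0); [lra |].
destruct (Rle_dec s 1); [lra | reflexivity].
Qed.

Lemma is_derive_piecewise (f g h f' g' h' : R -> C) (s : R) :
  s <> 0%R -> s <> 1%R ->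
  is_derive f s (f' s) -> is_derive g s (g' s) -> is_derive h s (h' s) ->
  is_derive (piecewise f g h) s (piecewise f' g' h' s).
Proof.
intros H0 H1 Hf Hg Hh.
destruct (Rlt_dec s 0) as [Hs | Hs].
- rewrite piecewise_below by lra.
  refine (is_derive_ext_loc _ _ _ _ _ Hf).
  refine (filter_imp _ _ _ (open_lt 0 s Hs)).
  intros y Hy; symmetry; apply piecewise_below; now apply Rlt_le.
- destruct (Rlt_dec s 1) as [Hs' | Hs'].
  + rewrite piecewise_inside by lra.
    refine (is_derive_ext_loc _ _ _ _ _ Hg).
    assert (Hs0 : (0 < s)%R) by lra.
    refine (filter_imp _ _ _ (filter_and _ _ (open_gt 0 s Hs0) (open_lt 1 s Hs'))).
    intros y [Hy Hy']; symmetry; apply piecewise_inside; split; [exact Hy | now apply Rlt_le].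
  + assert (Hs1 : (1 < s)%R) by lra.
    rewrite piecewise_above by exact Hs1.
    refine (is_derive_ext_loc _ _ _ _ _ Hh).
    refine (filter_imp _ _ _ (open_gt 1 s Hs1)).
    intros y Hy; symmetry; now apply piecewise_above.
Qed.

Lemma continuous_piecewise_0 (f g h : R -> C) :
  continuous f 0 -> continuous g 0 -> f 0%R = g 0%R ->
  continuous (piecewise f g h) 0.
Proof.
intros Hf Hg E; apply filterlim_locally'_continuous.
rewrite piecewise_below by lra.
apply filterlim_locally'_sides.
- apply (filterlim_ext_loc f).
  + refine (filter_imp _ _ _ (at_left_lt (- (1)) 0 _)); [| lra].
    intros y Hy; symmetry; apply piecewise_below; lra.
  + exact (filterlim_filter_le_1 _ (filter_le_within _) Hf).
- rewrite E; apply (filterlim_ext_loc g).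
  + refine (filter_imp _ _ _ (at_right_lt 0 1 _)); [| lra].
    intros y Hy; symmetry; apply piecewise_inside; lra.
  + exact (filterlim_filter_le_1 _ (filter_le_within _) Hg).
Qed.

Lemma continuous_piecewise_1 (f g h : R -> C) :
  continuous g 1 -> continuous h 1 -> g 1%R = h 1%R ->
  continuous (piecewise f g h) 1.
Proof.
intros Hg Hh E; apply filterlim_locally'_continuous.
rewrite piecewise_inside by lra.
apply filterlim_locally'_sides.
- apply (filterlim_ext_loc g).
  + refine (filter_imp _ _ _ (at_left_lt 0 1 _)); [| lra].
    intros y Hy; symmetry; apply piecewise_inside; lra.
  + exact (filterlim_filter_le_1 _ (filter_le_within _) Hg).
- rewrite E; apply (filterlim_ext_loc h).
  + refine (filter_imp _ _ _ (at_right_lt 1 2 _)); [| lra].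
    intros y Hy; symmetry; apply piecewise_above; lra.
  + exact (filterlim_filter_le_1 _ (filter_le_within _) Hh).
Qed.

Lemma continuous_Cscal (a : C) (f : R -> C) (x : R) :
  continuous f x -> continuous (fun s => a * f s) x.
Proof. intros H; apply filterlim_Cmult; [apply _ | apply filterlim_const | exact H]. Qed.

(** Turns the flux, whose coefficient jumps, into a glued function that is continuous once its
    pieces match. At [s = 1] the two sides may differ: the coefficient takes its outer value there,
    [piecewise] its inner piece. *)
Lemma inv_tau2_piecewise (eta s : R) (f g h : R -> C) :
  s <> 0%R -> s <> 1%R ->
  RtoC (inv_tau2 eta s) * piecewise f g h s =
  piecewise f (fun y => eta * g y) h s.
Proof.
intros H0 H1; unfold inv_tau2.
destruct (Rlt_dec s 0) as [Hs | Hs].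
- rewrite layered_below, !piecewise_below by lra; ring.
- destruct (Rlt_dec s 1) as [Hs' | Hs'].
  + rewrite layered_inside, !piecewise_inside by lra; reflexivity.
  + rewrite layered_above, !piecewise_above by lra; ring.
Qed.

Lemma locally_off_interfaces (s : R) :
  s <> 0%R -> s <> 1%R -> locally s (fun y => y <> 0%R /\ y <> 1%R).
Proof.
intros H0 H1.
refine (filter_imp _ _ _ (filter_and _ _ (open_neq 0 s H0) (open_neq 1 s H1))).
tauto.
Qed.

(** Separation of variables: the field is $e^{i\kappa x_1}w(x_2)$ with [w] glued from three waves.
    The inner amplitudes are chosen to match at $x_2=0$; the two equations then give the matching at
    $x_2=1$. *)
Lemma system_scattering_coefficients (eta k theta : R) (r t : C) :
  (0 < eta)%R ->
  let c := cos theta in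
  c * (r - 1) + eta * (1 + r) = (eta - c) * t * expi k ->
  c * (r - 1) - eta * (1 + r) = - (c + eta) * t * expi (- k) ->
  scattering_coefficients eta k theta r t.
Proof.
intros Heta c S1 S2; unfold scattering_coefficients.
fold c; set (kappa := (k * sin theta)%R); set (zeta := (k * c)%R).
assert (HetaC : RtoC eta <> 0) by (apply RtoC_neq_0; lra).
assert (H2 : RtoC 2 <> 0) by (apply RtoC_neq_0; lra).
(* the inner field has Cauchy data [t] and [- i zeta t / eta] at [x2 = 0] *)
set (a := (eta - c) * t / (2 * eta)); set (b := (eta + c) * t / (2 * eta)).
set (low := wave 0 t zeta); set (mid := wave a b k).
set (up := wave (r * expi (- zeta)) (expi zeta) zeta).
set (low' := fun s => Ci * zeta * wave 0 (- t) zeta s).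
set (mid' := fun s => Ci * k * wave a (- b) k s).
set (up' := fun s => Ci * zeta * wave (r * expi (- zeta)) (- expi zeta) zeta s).
set (w := piecewise low mid up); set (v := piecewise low' mid' up').
(* Equals [inv_tau2] times [v] off the faces and, unlike that product, will be continuous on
   them. *)
set (flux := piecewise low' (fun s => eta * mid' s) up').
assert (Ek : k * c = zeta :> C) by (unfold zeta; now rewrite RtoC_mult).
assert (Mid0 : low 0%R = mid 0%R).
{ unfold low, mid; rewrite wave_at_0; unfold wave, a, b; rewrite !Rmult_0_r, expi_0.
  field; assumption. }
assert (Mid0' : low' 0%R = eta * mid' 0%R).
{ unfold low', mid'; rewrite wave_at_0, <- Ek.
  unfold wave, a, b; rewrite !Rmult_0_r, expi_0.
  field; assumption. }
(* The sum of the right-hand sides of [Ea] and [Eb] is $1+r$ and their difference is $c(r-1)/\eta$: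
   the trace and flux conditions at the upper face. *)
assert (Ea : a * expi k = (c * (r - 1) + eta * (1 + r)) / (2 * eta))
  by (rewrite S1; unfold a; field; assumption).
assert (Eb : b * expi (- k) = - (c * (r - 1) - eta * (1 + r)) / (2 * eta))
  by (rewrite S2; unfold b; field; assumption).
assert (Mid1 : mid 1%R = up 1%R).
{ unfold mid, up; rewrite wave_reflected_at_1; unfold wave.
  rewrite !Rmult_1_r, Ea, Eb; field; assumption. }
assert (Mid1' : eta * mid' 1%R = up' 1%R).
{ unfold mid', up'; rewrite wave_reflected_flux_at_1, <- Ek; unfold wave.
  rewrite !Rmult_1_r.
  replace (- b * expi (- k)) with (- (b * expi (- k))) by ring.
  rewrite Ea, Eb; field; assumption. }
assert (Cl : forall s, continuous low s)
  by (intros s; exact (is_derive_C_continuous _ _ _ (is_derive_wave _ _ _ s))).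
assert (Cm : forall s, continuous mid s)
  by (intros s; exact (is_derive_C_continuous _ _ _ (is_derive_wave _ _ _ s))).
assert (Cu : forall s, continuous up s)
  by (intros s; exact (is_derive_C_continuous _ _ _ (is_derive_wave _ _ _ s))).
assert (Cl' : forall s, continuous low' s)
  by (intros s; exact (is_derive_C_continuous _ _ _ (is_derive_dwave _ _ _ s))).
assert (Cm' : forall s, continuous (fun y => eta * mid' y) s)
  by (intros s; apply continuous_Cscal;
      exact (is_derive_C_continuous _ _ _ (is_derive_dwave _ _ _ s))).
assert (Cu' : forall s, continuous up' s)
  by (intros s; exact (is_derive_C_continuous _ _ _ (is_derive_dwave _ _ _ s))).
assert (Dw : forall s, s <> 0%R -> s <> 1%R -> is_derive w s (v s)).
{ intros s H0 H1; apply is_derive_piecewise; try assumption; apply is_derive_wave. }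
assert (Dflux : forall s, s <> 0%R -> s <> 1%R ->
  is_derive flux s (piecewise (fun y => - (zeta ^ 2)%R * low y)
    (fun y => eta * (- (k ^ 2)%R * mid y)) (fun y => - (zeta ^ 2)%R * up y) s)).
{ intros s H0 H1; apply is_derive_piecewise; try assumption;
    [apply is_derive_dwave | apply is_derive_Cscal, is_derive_dwave | apply is_derive_dwave]. }
(* [e] will be the horizontal phase $e^{i\kappa x_1}$. *)
assert (Fluxeq : forall e s, s <> 0%R -> s <> 1%R ->
  e * flux s = RtoC (inv_tau2 eta s) * (e * v s)).
{ intros e s H0 H1; unfold flux; rewrite <- inv_tau2_piecewise by assumption.
  fold v; ring. }
assert (Fluxlim : forall e x, x = 0%R \/ x = 1%R -> continuous flux x ->
  exists l : C, filterlim (fun s : R => RtoC (inv_tau2 eta s) * (e * v s))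
                  (locally' x) (locally l)).
{ intros e x Hx Hc; exists (e * flux x).
  apply (filterlim_ext_loc (fun s => e * flux s)).
  - unfold locally', within.
    (* The punctured filter avoids the face [x] itself; [N] avoids the other one, so [Fluxeq]
       applies. *)
    assert (N : locally x (fun y => x = 0%R /\ y <> 1%R \/ x = 1%R /\ y <> 0%R)).
    { destruct Hx as [-> | ->].
      - refine (filter_imp _ _ _ (open_neq 1 0 _)); [intros y Hy; left; now split | lra].
      - refine (filter_imp _ _ _ (open_neq 0 1 _)); [intros y Hy; right; now split | lra]. }
    refine (filter_imp _ _ _ N).
    intros y [[-> Hy] | [-> Hy]] Hy'; apply Fluxeq; assumption.
  - exact (filterlim_filter_le_1 _ (filter_le_within _) (continuous_Cscal e _ _ Hc)). }
assert (Dexp : forall x1 x2 : R,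
  is_derive (fun s => expi (kappa * s) * w x2) x1 (Ci * kappa * (expi (kappa * x1) * w x2))).
{ intros x1 x2.
  replace (Ci * kappa * (expi (kappa * x1) * w x2))
    with (Ci * kappa * expi (kappa * x1) * w x2 + expi (kappa * x1) * 0) by ring.
  apply (is_derive_Cmult (fun s => expi (kappa * s)) (fun _ => w x2));
    [apply is_derive_expi | apply is_derive_Cconst]. }
exists (fun x1 x2 => expi (kappa * x1) * w x2).
exists (fun x1 x2 => Ci * kappa * (expi (kappa * x1) * w x2)).
exists (fun x1 x2 => expi (kappa * x1) * v x2).
split; [| split; [| split; [| split; [| split]]]].
- intros x1 x2 H0 H1; split; [apply Dexp | now apply is_derive_Cscal, Dw].
- intros x1 x2 H0 H1.
  exists (RtoC (inv_tau1 x2) * (Ci * kappa * (Ci * kappa * (expi (kappa * x1) * w x2)))).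
  exists (expi (kappa * x1) *
    piecewise (fun y => - (zeta ^ 2)%R * low y)
    (fun y => eta * (- (k ^ 2)%R * mid y)) (fun y => - (zeta ^ 2)%R * up y) x2).
  split; [| split].
  + apply is_derive_Cscal, is_derive_Cscal, Dexp.
  + refine (is_derive_ext_loc _ _ _ _ _ (is_derive_Cscal (expi (kappa * x1)) _ _ _ (Dflux x2 H0 H1))).
    refine (filter_imp _ _ _ (locally_off_interfaces x2 H0 H1)).
    intros y [Hy0 Hy1]; now apply Fluxeq.
  (* This dispersion relation settles the equation outside; inside, the horizontal term is zero and
     $\eta k^2$ cancels. *)
  + assert (Ekz : (k ^ 2 = kappa ^ 2 + zeta ^ 2)%R).
    { unfold kappa, zeta, c.
      transitivity (k ^ 2 * (Rsqr (sin theta) + Rsqr (cos theta)))%R;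
        [rewrite sin2_cos2 | unfold Rsqr]; ring. }
    assert (Eii : forall z, Ci * kappa * (Ci * kappa * z) = - (kappa ^ 2)%R * z).
    { intros z; rewrite RtoC_pow.
      transitivity (Ci * Ci * (kappa ^ 2 * z)); [ring | rewrite Ci_sqr; ring]. }
    rewrite Eii; unfold inv_tau1, mu, w.
    destruct (Rlt_dec x2 0) as [Hs | Hs].
    * rewrite !layered_below, !piecewise_below, Rmult_1_r, Ekz, RtoC_plus by lra; ring.
    * destruct (Rlt_dec x2 1) as [Hs' | Hs'].
      -- rewrite !layered_inside, !piecewise_inside, RtoC_mult by lra; ring.
      -- rewrite !layered_above, !piecewise_above, Rmult_1_r, Ekz, RtoC_plus by lra; ring.
- intros x1; split.
  + apply continuous_Cscal, continuous_piecewise_0; auto.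
  + apply Fluxlim; [now left |]; apply continuous_piecewise_0; auto.
- intros x1; split.
  + apply continuous_Cscal, continuous_piecewise_1; auto.
  + apply Fluxlim; [now right |]; apply continuous_piecewise_1; auto.
- intros x1 x2 Hx; rewrite incident_reflected_wave; unfold w.
  rewrite piecewise_above by exact Hx; reflexivity.
- intros x1 x2 Hx; rewrite transmitted_wave; unfold w.
  rewrite piecewise_below by lra; reflexivity.
Qed.

(** The equivalence in the first conjunct gives existence and uniqueness of the scattering
    coefficients, so that (a) and (b) concern the physical problem and not merely two formulas. *)
Theorem mainTheorem6 :
  forall eta : R, (0 < eta < 1)%R ->
    (forall k theta : R, (0 < k)%R -> (Rabs theta < PI / 2)%R ->
       forall r t : C,
         scattering_coefficients eta k theta r t <->
         r = refl_coef eta k theta /\ t = trans_coef eta k theta) /\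
    (forall (k : R) (m : nat), (0 < m)%nat -> k = (INR m * PI)%R ->
       forall theta : R, (Rabs theta < PI / 2)%R ->
         Cmod (trans_coef eta k theta) = 1%R /\
         refl_coef eta k theta = RtoC 0) /\
    (forall theta : R, (Rabs theta < PI / 2)%R -> cos theta = eta ->
       forall k : R, (0 < k)%R ->
         Cmod (trans_coef eta k theta) = 1%R /\
         refl_coef eta k theta = RtoC 0).
Proof.
intros eta [Heta _].
assert (Hcos : forall theta : R, (Rabs theta < PI / 2)%R -> (0 < cos theta)%R).
{ intros theta [H1 H2]%Rabs_def2; now apply cos_gt_0. }
split; [| split].
- intros k theta Hk Htheta r t.
  rewrite <- scattering_system_iff by auto; split.
  + now apply scattering_coefficients_system.
  + intros [S1 S2]; now apply system_scattering_coefficients.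
- intros k m _ -> theta Htheta.
  apply total_transmission_resonance; auto.
  apply sin_eq_0_1; exists (Z.of_nat m); now rewrite <- INR_IZR_INZ.
- intros theta _ Hc k _; now apply total_transmission_matched.
Qed.
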